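(* Let $n\ge d\ge 2$. Every complete subgraph of the graph of the multiplex $M^{d,n}$ is the graph of a face of $M^{d,n}$.
   Context: A $d$-dimensional multiplex is a $d$-dimensional convex polytope with an ordered list of vertices $x_0,x_1,\ldots,x_n$ whose facets are exactly $F_0,F_1,\ldots,F_n$, where $F_i=\mathrm{conv}\{x_{i-d+1},x_{i-d+2},\ldots,x_{i-1},x_{i+1},x_{i+2},\ldots,x_{i+d-1}\}$, with the conventions that $x_j=x_0$ if $j<0$ and $x_j=x_n$ if $j>n$. For all $n\ge d\ge 2$, such a polytope exists (a known result), and its face lattice is determined by $d$ and $n$; $M^{d,n}$ denotes the $d$-dimensional multiplex with $n+1$ vertices. The graph of a polytope has as its vertices and edges the vertices and ($1$-dimensional) edges of the polytope. Here ''face'' includes the polytope itself (for example when $n=d$, where $M^{d,d}$ is the $d$-simplex). *)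

(* Defs.v *)
From mathcomp Require Import all_boot all_order all_algebra.
From mathcomp Require Import all_classical reals convex.

Set Implicit Arguments.
Unset Strict Implicit.
Unset Printing Implicit Defensive.

Import Order.TTheory GRing.Theory Num.Theory.

Local Open Scope classical_set_scope.
Local Open Scope ring_scope.

Record sgraph (T : Type) := SGraph {
  gvert : set T;
  gadj : T -> T -> Prop;
  gadj_vert : forall u v, gadj u v -> gvert u /\ gvert v;
  gadj_irr : forall u, ~ gadj u u;
  gadj_sym : forall u v, gadj u v -> gadj v u }.

Definition subgraph (T : Type) (G H : sgraph T) : Prop :=
  gvert G `<=` gvert H /\ (forall u v, gadj G u v -> gadj H u v).

Definition complete_graph (T : Type) (G : sgraph T) : Prop :=
  forall u v, gvert G u -> gvert G v -> u <> v -> gadj G u v.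

Section Polytopes.
Context {R : realType} {m : nat}.
Local Notation E := 'rV[R]_m.
Implicit Types (P F A : set E) (u v p : E) (k d n : nat).

Definition convex_hull A : set E := smallest (@convex_set R E) A.

Definition affine_set A : Prop :=
  forall u v (t : R), A u -> A v -> A (t *: u + (1 - t) *: v).

Definition affine_hull A : set E := smallest affine_set A.

(* The empty set has no dimension in this sense. *)
Definition has_dim A k : Prop :=
  exists p (V : {vspace E}),
    \dim V = k /\ affine_hull A = [set p + v | v in [set` V]].

(* The functional [a] may be zero, so that [P] itself and the empty set are
   faces of [P]. *)
Definition face P F : Prop :=
  exists (a : 'cV[R]_m) (b : R),
    (forall p, P p -> (p *m a) 0 0 <= b) /\
    F = P `&` [set p | (p *m a) 0 0 = b].

Definition facet P F : Prop :=
  exists k, [/\ has_dim P k.+1, face P F & has_dim F k].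

Definition vertex P v : Prop := face P [set v].

Definition edge P F : Prop := face P F /\ has_dim F 1.

Definition polytope_adj P u v : Prop :=
  [/\ vertex P u, vertex P v, u <> v & edge P (convex_hull [set u; v])].

Lemma polytope_adj_vert P u v :
  polytope_adj P u v -> [set w | vertex P w] u /\ [set w | vertex P w] v.
Proof. by case. Qed.

Lemma polytope_adj_irr P u : ~ polytope_adj P u u.
Proof. by case. Qed.

Lemma polytope_adj_sym P u v : polytope_adj P u v -> polytope_adj P v u.
Proof. by case=> Pu Pv uv e; split=> //; [exact: nesym | rewrite setUC]. Qed.

Definition polytope_graph P : sgraph E :=
  SGraph (@polytope_adj_vert P) (@polytope_adj_irr P) (@polytope_adj_sym P).

Definition clamped n (x : 'I_n.+1 -> E) (j : int) : E :=
  if j < 0 then x ord0 else if n%:Z < j then x ord_max else x (inord `|j|%N).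

Definition multiplex_facet d n (x : 'I_n.+1 -> E) (i : 'I_n.+1) : set E :=
  convex_hull [set clamped x j | j in
    [set j : int | i%:Z - d%:Z + 1 <= j <= i%:Z + d%:Z - 1 /\ j <> i%:Z]].

Definition multiplex d n P (x : 'I_n.+1 -> E) : Prop :=
  [/\ P = convex_hull (range x) /\ has_dim P d,
      injective x,
      [set v | vertex P v] = range x
    & [set F | facet P F] = range (multiplex_facet d x)].

End Polytopes.

(* Main.v *)
(** A nonempty face of a polytope missing a vertex [q] lies in a facet missing
[q]: rotate a supporting hyperplane about its contact set, keeping its slack at
[q] constant, until the contact set spans a hyperplane of the affine hull.  So
if [x_i x_j] is an edge of the multiplex and [k] differs from [i] and [j], some
facet contains [x_i] and [x_j] but not [x_k].  Taking [k] to be [i + 1] or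
[i - 1], this forces, for [i < j], that [j - i <= d] and that [j - i = d - 1]
only when [i = 0] or [j = n].  These constraints on the pairs of a clique [S]
yield, for every [k] outside [S], a facet containing [S] and not [x_k]; the
intersection of these facets is a face with vertex set [S]. *)
Require Import Defs.
From mathcomp Require Import all_boot all_order all_algebra.
From mathcomp Require Import all_classical reals convex interval_inference.
From mathcomp Require Import zify ring lra.

Set Implicit Arguments.
Unset Strict Implicit.
Unset Printing Implicit Defensive.

Import Order.TTheory GRing.Theory Num.Theory.

Local Open Scope classical_set_scope.
Local Open Scope ring_scope.

(** * Combinatorics of facet-vertex incidences *)

(* The vertex [x_j] lies on the facet [F_l]; the convention [x_i = x_0] for
   [i < 0] (resp. [x_i = x_n] for [i > n]) puts [x_0] on [F_0] and [x_n] on [F_n]. *)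
Definition on_facet (d n l j : nat) : bool :=
  (l == j) && ((l == 0)%N || (l == n)) ||
  [&& l != j, (l < j + d)%N & (j < l + d)%N].

(** The vertices of [F_l] fill an interval of indices, with [l] itself removed unless it is [0] or
    [n]. A facet through [x_i] and [x_j] missing [x_{i+1}] strictly between them is therefore
    [F_{i+1}], which reaches no further than [x_{i+d}]. *)
Lemma on_facet_edge d n (i j : 'I_n.+1) : (2 <= d <= n)%N -> (i < j)%N ->
  (forall k : 'I_n.+1, k != i -> k != j ->
    exists l : 'I_n.+1, [/\ on_facet d n l i, on_facet d n l j & ~~ on_facet d n l k]) ->
  (j <= i + d)%N /\ (j.+1 = i + d -> i = 0 :> nat \/ j = n :> nat)%N.
Proof.
move=> /andP[d2 dn] ij pij; have jn := ltn_ord j.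
have sep (k : nat) : (k <= n)%N -> k <> i -> k <> j ->
    exists l : 'I_n.+1, [/\ on_facet d n l i, on_facet d n l j & ~~ on_facet d n l k].
  by move=> kn /eqP ki /eqP kj; exact: (pij (Ordinal (kn : (k < n.+1)%N))).
split=> [|jE].
  rewrite leqNgt; apply/negP => ijd.
  have [|||l] := sep i.+1; [lia..|]; have := ltn_ord l.
  by move=> ? []; rewrite /on_facet; lia.
have [|i0] := eqVneq (i : nat) 0%N; first by left.
have [|jn'] := eqVneq (j : nat) n; first by right.
(* A facet through [x_i] missing [x_{i-1}] is either [F_{i-1}], which stops short of [x_j], or one
   whose interval begins at [i], hence [F_j], which misses [x_j]. *)
have [|||l] := sep i.-1; [lia..|]; have := ltn_ord l.
by move=> ? []; rewrite /on_facet; lia.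
Qed.

(** The clique lies between its least index [i] and its greatest index [j], and the facet is chosen
    by the position of [k] relative to this range. [F_k] itself serves whenever it misses [x_k] and
    reaches the whole range. *)
Lemma on_facet_clique d n (S : pred 'I_n.+1) (s0 k : 'I_n.+1) :
  (2 <= d <= n)%N -> S s0 -> ~~ S k ->
  (forall i j k : 'I_n.+1, S i -> S j -> k != i -> k != j ->
    exists l : 'I_n.+1, [/\ on_facet d n l i, on_facet d n l j & ~~ on_facet d n l k]) ->
  exists l : 'I_n.+1, (forall s, S s -> on_facet d n l s) /\ ~~ on_facet d n l k.
Proof.
move=> dn s0S kS pairS.
have [i iS imin] := arg_minnP (fun t : 'I_n.+1 => t : nat) s0S.
have [j jS jmax] := arg_maxnP (fun t : 'I_n.+1 => t : nat) s0S.
have kN s : S s -> (k <> s :> nat).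
  by move=> sS /val_inj ks; rewrite ks sS in kS.
have edge (u v : 'I_n.+1) : S u -> S v -> (u < v)%N ->
    (v <= u + d)%N /\ (v.+1 = u + d -> u = 0 :> nat \/ v = n :> nat)%N.
  by move=> uS vS uv; apply: on_facet_edge => // w; exact: pairS.
have witness (l : nat) : (l <= n)%N ->
    (forall s, S s -> on_facet d n l s) -> ~~ on_facet d n l k ->
    exists l : 'I_n.+1, (forall s, S s -> on_facet d n l s) /\ ~~ on_facet d n l k.
  by move=> ln lS lk; exists (Ordinal (ln : (l < n.+1)%N)).
have bounds s : S s -> [/\ (i <= s)%N, (s <= j)%N, (s < n.+1)%N & k <> s :> nat].
  by move=> sS; split; [exact: imin|exact: jmax|exact: ltn_ord|exact: kN].
have [_ ij jn ki] := bounds i iS; have [_ _ jn' kj] := bounds j jS.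
have kn := ltn_ord k; move/andP: dn => [d2 dn].
have [iEj|iNj] := eqVneq i j.
  have kiN : k != i by apply: contra_not_neq ki => ->.
  have [l [li _ lk]] := pairS i i k iS iS kiN kiN.
  exists l; split=> // s /bounds [? ? _ _].
  by have -> : s = i by apply: val_inj; move: iEj => /(congr1 val) /=; lia.
have {ij} {iNj} ij : (i < j)%N by rewrite ltn_neqAle iNj ij.
have [ijd ijE] := edge i j iS jS ij.
have [ki'|ik] := ltnP k i.
  have [jE|jN] := eqVneq (j : nat) (i + d)%N.
    (* [F_{j-1}] begins exactly at [x_i]. Its gap [j - 1] is not in [S]: it would be at distance
       [d - 1] from [i], with [i > 0] and [j - 1 < n]. *)
    apply: (witness j.-1); [lia| |rewrite /on_facet; lia].
    move=> s sS; have [? ? ? ?] := bounds s sS; have := edge i s iS sS.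
    by rewrite /on_facet; lia.
  have [jE|jN'] := eqVneq (j.+1 : nat) (i + d)%N.
    (* Since [i > 0], the edge constraint gives [j = n], so [F_n] begins at [x_i]. *)
    apply: (witness n); [lia| |rewrite /on_facet; lia].
    by move=> s sS; have [? ? ? ?] := bounds s sS; rewrite /on_facet; lia.
  have [jk|jk] := ltnP j (k + d); last first.
    (* Now [j <= i + d - 2], so the facet just past the clique reaches back to [x_i] but not to
       [x_k]. If [j = n] the index is capped at [n], and [F_n] contains [x_n]. *)
    apply: (witness (minn j.+1 n)); [lia| |rewrite /on_facet; lia].
    by move=> s sS; have [? ? ? ?] := bounds s sS; rewrite /on_facet; lia.
  have [k0|k0] := eqVneq (k : nat) 0%N.
    (* [F_0] contains [x_0], so [F_d] is used: it begins at [x_1], and its gap [d] exceeds [j]. *)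
    apply: (witness d); [lia| |rewrite /on_facet; lia].
    by move=> s sS; have [? ? ? ?] := bounds s sS; rewrite /on_facet; lia.
  apply: (witness k); [lia| |rewrite /on_facet; lia].
  by move=> s sS; have [? ? ? ?] := bounds s sS; rewrite /on_facet; lia.
have [kj'|jk] := ltnP k j.
  apply: (witness k); [lia| |rewrite /on_facet; lia].
  by move=> s sS; have [? ? ? ?] := bounds s sS; rewrite /on_facet; lia.
(* The case [k > j] mirrors [k < i] under reversal of the indices; truncation in [i.-1] plays the
   part of the cap at [n]. *)
have [jE|jN] := eqVneq (j : nat) (i + d)%N.
  apply: (witness i.+1); [lia| |rewrite /on_facet; lia].
  move=> s sS; have [? ? ? ?] := bounds s sS; have := edge s j sS jS.
  by rewrite /on_facet; lia.
have [jE|jN'] := eqVneq (j.+1 : nat) (i + d)%N.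
  apply: (witness 0%N); [lia| |rewrite /on_facet; lia].
  by move=> s sS; have [? ? ? ?] := bounds s sS; rewrite /on_facet; lia.
have [kid|kid] := ltnP k (i + d); last first.
  apply: (witness i.-1); [lia| |rewrite /on_facet; lia].
  by move=> s sS; have [? ? ? ?] := bounds s sS; rewrite /on_facet; lia.
have [kn'|kn'] := eqVneq (k : nat) n.
  apply: (witness (n - d)%N); [lia| |rewrite /on_facet; lia].
  by move=> s sS; have [? ? ? ?] := bounds s sS; rewrite /on_facet; lia.
apply: (witness k); [lia| |rewrite /on_facet; lia].
by move=> s sS; have [? ? ? ?] := bounds s sS; rewrite /on_facet; lia.
Qed.

Section Polytopes.
Context {R : realType} {m : nat}.
Local Notation E := 'rV[R]_m.
Local Notation "p '* a" := ((p *m a) 0 0) (at level 40).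
Implicit Types (P Q F A B : set E) (a : 'cV[R]_m) (b t : R) (s : seq E).

(** * Supporting functionals, convex hulls and faces *)

Lemma dotDl (p q : E) a : (p + q) '* a = p '* a + q '* a.
Proof. by rewrite mulmxDl mxE. Qed.

Lemma dotZl t (p : E) a : (t *: p) '* a = t * (p '* a).
Proof. by rewrite -scalemxAl mxE. Qed.

Lemma dotBl (p q : E) a : (p - q) '* a = p '* a - q '* a.
Proof. by rewrite mulmxBl !mxE. Qed.

Lemma dotDr (p : E) a a' : p '* (a + a') = p '* a + p '* a'.
Proof. by rewrite mulmxDr mxE. Qed.

Lemma dotZr t (p : E) a : p '* (t *: a) = t * (p '* a).
Proof. by rewrite -scalemxAr mxE. Qed.

Lemma convex_setI01 A :
  (forall (u v : E) t, 0 < t -> t < 1 -> A u -> A v -> A (t *: u + (1 - t) *: v)) ->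
  convex_set (A : set (convex_lmodType E)).
Proof.
move=> cA; apply/convex_setW => u v /set_mem Au /set_mem Av t t0 t1.
by apply/mem_set; exact: cA.
Qed.

Lemma convex_hull_convex A (u v : E) t : 0 < t -> t < 1 ->
  convex_hull A u -> convex_hull A v -> convex_hull A (t *: u + (1 - t) *: v).
Proof.
move=> t0 t1 Au Av C [cC AC].
have t01 : 0 <= t <= 1 by rewrite !ltW.
by apply/set_mem; apply: (cC u v (Itv01 (ltW t0) (ltW t1)));
  apply/mem_set; [apply: Au | apply: Av].
Qed.

Lemma sub_convex_hull A : A `<=` convex_hull A.
Proof. exact: sub_gen_smallest. Qed.

Lemma convex_hull_min A B : A `<=` convex_hull B -> convex_hull A `<=` convex_hull B.
Proof.
move=> AB; apply: smallest_sub => //.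
by apply: convex_setI01 => u v t t0 t1; exact: convex_hull_convex.
Qed.

Lemma convex_hull0 : convex_hull (set0 : set E) = set0.
Proof. by apply: smallest_id; apply: convex_setI01 => u v t _ _ []. Qed.

Lemma convex_hull_le A a b :
  (forall p, A p -> p '* a <= b) -> forall p, convex_hull A p -> p '* a <= b.
Proof.
move=> Ab; apply: smallest_sub => //.
apply: convex_setI01 => u v t t0 t1 /= ub vb; rewrite dotDl !dotZl; nra.
Qed.

Lemma convex_hull_tight A a b : (forall p, A p -> p '* a <= b) ->
  convex_hull A `&` [set p | p '* a = b] =
  convex_hull (A `&` [set p | p '* a = b]).
Proof.
move=> Ab; set T := A `&` _; apply/seteqP; split; last first.
  move=> p Tp; split.
    by apply: convex_hull_min Tp => q [Aq _]; exact: sub_convex_hull.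
  apply/eqP; rewrite eq_le; apply/andP; split.
    by apply: convex_hull_le Tp => q [Aq _]; exact: Ab.
  (* The reverse inequality is the hull bound for the functional [-a]. *)
  rewrite -lerN2 -mulN1r -dotZr.
  by apply: convex_hull_le Tp => q [_ <-]; rewrite dotZr mulN1r.
(* The set of points strictly below [b] or in the hull of [T] is convex. *)
pose C := [set p : E | p '* a < b \/ (p '* a = b /\ convex_hull T p)].
suff AC : convex_hull A `<=` C by move=> p [/AC[/= + pb|[]//]]; rewrite pb ltxx.
apply: smallest_sub => [|p Ap]; last first.
  have := Ab p Ap; rewrite le_eqVlt => /predU1P[pb|]; last by left.
  by right; split=> //; apply: sub_convex_hull.
apply: convex_setI01 => u v t t0 t1; rewrite /C /= dotDl !dotZl.
move=> [ub|[ub Tu]] [vb|[vb Tv]]; try by left; nra.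
right; rewrite ub vb; split; first by ring.
exact: convex_hull_convex.
Qed.

(** The same functional supports [Q]. This carries vertices and edges of the multiplex over to the
    face spanned by a clique. *)
Lemma face_sub P Q F : face P F -> F `<=` Q -> Q `<=` P -> face Q F.
Proof.
move=> [a [b [Pb ->]]] FQ QP; exists a, b; split=> [p /QP /Pb//|].
by apply/seteqP; split=> p [] => [Pp pb|/QP]; split=> //; apply: FQ.
Qed.

(** Add the two functionals: equality in the sum of the bounds forces equality in each. *)
Lemma faceI P F1 F2 : face P F1 -> face P F2 -> face P (F1 `&` F2).
Proof.
move=> [a1 [b1 [P1 ->]]] [a2 [b2 [P2 ->]]]; exists (a1 + a2), (b1 + b2).
split=> [p Pp|]; first by rewrite dotDr lerD ?P1 ?P2.
apply/seteqP; split=> p /=; rewrite dotDr; first by move=> [[? ->] [_ ->]].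
by move=> [Pp pb]; have := P1 p Pp; have := P2 p Pp; do !split=> //; lra.
Qed.

Lemma face_full P : face P P.
Proof.
exists 0, 0; split=> [p _|]; first by rewrite mulmx0 mxE.
by apply/seteqP; split=> p => [|[]//]; split=> //=; rewrite mulmx0 mxE.
Qed.

Lemma face_set0 P : face P set0.
Proof.
exists 0, 1; split=> [p _|]; first by rewrite mulmx0 mxE ler01.
apply/seteqP; split=> p //= [_] /=; rewrite mulmx0 mxE => /esym/eqP.
by rewrite oner_eq0.
Qed.

Lemma face_convex_hull A F :
  face (convex_hull A) F -> F = convex_hull (A `&` F).
Proof.
move=> [a [b [Ab FE]]].
have Ab' p : A p -> p '* a <= b by move=> Ap; apply: Ab; exact: sub_convex_hull.
rewrite {1}FE convex_hull_tight //; congr convex_hull.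
rewrite FE; apply/seteqP; split=> p [] => [Ap pb|Ap [_ pb]] //.
by do !split=> //; exact: sub_convex_hull.
Qed.

(** The singleton of [v] is a face of the hull of [A], hence the hull of the generators it contains,
    so there is at least one. *)
Lemma vertex_convex_hull P A v :
  vertex P v -> A `<=` P -> convex_hull A `<=` P -> convex_hull A v -> A v.
Proof.
move=> Pv AP hAP Av.
have /face_convex_hull vE : face (convex_hull A) [set v].
  by apply: face_sub Pv _ hAP => _ ->.
have [[w [Aw <-]]//|/nonemptyPn A0] := pselect (A `&` [set v] !=set0).
by have : [set v] v by []; rewrite vE A0 convex_hull0.
Qed.

(** * Direction spaces and dimension *)

(** For [p0] in [s] this is the linear space parallel to the affine hull of [s], so that dimensions
    of hulls become dimensions of spans. *)
Definition direction (p0 : E) s : {vspace E} := <<[seq q - p0 | q <- s]>>%VS.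

Lemma direction_mem (p0 q : E) s : q \in s -> q - p0 \in direction p0 s.
Proof. by move=> qs; apply/memv_span/map_f. Qed.

Lemma direction_sub (p0 : E) s (V : {vspace E}) :
  (forall q, q \in s -> q - p0 \in V) -> (direction p0 s <= V)%VS.
Proof. by move=> sV; apply/span_subvP => _ /mapP[q qs ->]; exact: sV. Qed.

Lemma affine_hull_convex_hull (p0 : E) s : p0 \in s ->
  affine_hull (convex_hull [set` s]) =
  [set p0 + v | v in [set` direction p0 s]].
Proof.
move=> p0s; apply/seteqP; split.
  apply: smallest_sub => [_ _ t [u uV <-] [v vV <-]|].
    exists (t *: u + (1 - t) *: v); first by rewrite /= memvD ?memvZ.
    by rewrite !scalerDr addrACA -scalerDl subrKC scale1r.
  apply: smallest_sub => [|q qs]; last first.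
    by exists (q - p0); rewrite ?subrKC//; exact: direction_mem.
  apply: convex_setI01 => _ _ t _ _ [u uV <-] [v vV <-].
  exists (t *: u + (1 - t) *: v); first by rewrite /= memvD ?memvZ.
  by rewrite !scalerDr addrACA -scalerDl subrKC scale1r.
set L := affine_hull _.
have aL : affine_set L.
  by move=> u v t Lu Lv B BE; apply: BE.1; [exact: Lu | exact: Lv].
have sL q : q \in s -> L q.
  by move=> qs; apply: sub_gen_smallest; exact: sub_convex_hull.
have LZ t v : L (p0 + v) -> L (p0 + t *: v).
  move=> Lv; have := aL _ _ t Lv (sL _ p0s).
  by rewrite scalerDr addrAC -scalerDl subrKC scale1r.
(* The sum [u + v] is the midpoint of [2u] and [2v]. *)
have LD u v : L (p0 + u) -> L (p0 + v) -> L (p0 + (u + v)).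
  move=> Lu Lv; have := aL _ _ 2^-1 (LZ 2 _ Lu) (LZ 2 _ Lv).
  have -> : 1 - 2^-1 = 2^-1 :> R by lra.
  rewrite !scalerDr !scalerA mulVf ?pnatr_eq0// !scale1r addrACA -scalerDl.
  by rewrite (_ : _ + _ = 1 :> R) ?scale1r//; lra.
move=> _ [v /= vV <-]; rewrite (@coord_span _ _ _ (in_tuple _) v vV).
elim/big_ind: _ => [||i _]; [by rewrite addr0; exact: sL| exact: LD|].
apply: LZ; have /mapP[q qs ->] := mem_nth 0 (ltn_ord i).
by rewrite subrKC; exact: sL.
Qed.

(** The space witnessing [has_dim] is thus unique, whatever the base point. *)
Lemma translate_vspace_inj (p q : E) (V W : {vspace E}) :
  [set p + v | v in [set` V]] = [set q + v | v in [set` W]] -> V = W.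
Proof.
have sub (p' q' : E) (V' W' : {vspace E}) :
    [set p' + v | v in [set` V']] = [set q' + v | v in [set` W']] ->
    (V' <= W')%VS.
  move=> e; have [w0 /= w0W /esym p'E] : [set q' + v | v in [set` W']] p'.
    by rewrite -e; exists 0; rewrite ?addr0//= mem0v.
  apply/subvP => v vV; have [w /= wW wE] : [set q' + v | v in [set` W']] (p' + v).
    by rewrite -e; exists v.
  have -> : v = w - w0; last by rewrite memvB.
  by apply: (addrI p'); rewrite -wE {1}p'E addrACA subrr addr0 // addrCA subrr addr0.
by move=> e; apply/eqP; rewrite eqEsubv (sub _ _ _ _ e) (sub _ _ _ _ (esym e)).
Qed.

Lemma has_dim_convex_hull (p0 : E) s k : p0 \in s ->
  has_dim (convex_hull [set` s]) k <-> \dim (direction p0 s) = k.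
Proof.
move=> p0s; split=> [[p [V [<-]]]|dk].
  by rewrite (affine_hull_convex_hull p0s) => /translate_vspace_inj ->.
by exists p0, (direction p0 s); split=> //; exact: affine_hull_convex_hull.
Qed.

(** * Rotating a supporting hyperplane onto a facet *)

(** The identity minus the projection onto [U] kills [U] but not [v]; the functional is a coordinate
    of this map that is nonzero at [v]. *)
Lemma separating_functional (U : {vspace E}) v : v \notin U ->
  exists a, (forall u, u \in U -> u '* a = 0) /\ v '* a != 0.
Proof.
move=> vU; pose f : 'End(E) := (\1 - projv U)%VF.
have fE u : f u = u - projv U u by rewrite add_lfunE opp_lfunE id_lfunE.
have fvN0 : f v != 0.
  by rewrite fE subr_eq0; apply: contraNneq vU => ->; exact: memv_proj.
have [j fvj] : exists j, f v 0 j != 0.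
  apply/existsP; apply: contraNT fvN0; rewrite negb_exists => /forallP f0.
  by apply/eqP/rowP => j; rewrite mxE; apply/eqP/negPn/f0.
have colE u : u '* (col j (lin1_mx f)) = f u 0 j.
  by rewrite -(mul_rV_lin1 f) [LHS]mxE [RHS]mxE; apply: eq_bigr => i _; rewrite mxE.
exists (col j (lin1_mx f)); rewrite colE; split=> // u uU.
by rewrite colE fE projv_id// subrr mxE.
Qed.

Definition tight s a b : seq E := [seq p <- s | p '* a == b].

Lemma dot_direction (p0 v : E) s a :
  (forall p, p \in s -> p '* a = p0 '* a) -> v \in direction p0 s -> v '* a = 0.
Proof.
move=> sa; have /subvP : (direction p0 s <= lker (linfun (mulmxr a)))%VS.
  apply: direction_sub => p /sa pa; rewrite memv_ker lfunE /=; apply/eqP/rowP => i.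
  by rewrite (ord1 i) dotBl pa subrr mxE.
by move=> /[apply]; rewrite memv_ker lfunE /= => /eqP ->; rewrite mxE.
Qed.

Lemma exists_minimizer (T : eqType) (f : T -> R) (s : seq T) : s != [::] ->
  exists2 r, r \in s & forall p, p \in s -> f r <= f p.
Proof.
elim: s => // p s IHs _; have [->|/IHs[r rs rmin]] := eqVneq s [::].
  by exists p => [|q]; rewrite mem_seq1 // => /eqP ->.
have [pr|rp] := leP (f p) (f r); [exists p | exists r];
  rewrite ?mem_head ?inE ?rs ?orbT// => q /predU1P[->//|/rmin rq]//.
- exact: le_trans rq.
- exact: ltW.
Qed.

(* Rotate the hyperplane about the tight points while keeping the slack at [q]
   fixed, until it hits a further point of [s]. *)
Lemma tilt (p0 q : E) s a b :
  (forall p, p \in s -> p '* a <= b) -> p0 '* a = b -> q '* a < b ->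
  ((\dim (direction p0 (tight s a b))).+1 < \dim (direction p0 s))%N ->
  exists a' b', [/\ forall p, p \in s -> p '* a' <= b',
    forall p, p \in s -> p '* a = b -> p '* a' = b', p0 '* a' = b', q '* a' < b' &
    (\dim (direction p0 (tight s a b)) <
     \dim (direction p0 (tight s a' b')))%N].
Proof.
move=> sab p0ab qab; set W := direction p0 (tight s a b) => dW.
have tightW p : p \in s -> p '* a = b -> p - p0 \in W.
  by move=> ps pab; apply: direction_mem; rewrite mem_filter pab eqxx.
(* A functional vanishing on [U] changes neither the tight points nor the slack at [q]. By the
   dimension gap, some [r] in [s] escapes [U]. *)
pose U := (W + <[q - p0]>)%VS.
have /allPn[r rs rU] : ~~ all (fun r => r - p0 \in U) s.
  apply: contraTN dW => /allP sU; rewrite -leqNgt.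
  rewrite (leq_trans (dimvS (direction_sub sU)))// (leq_trans (dimv_add_leqif _ _))//.
  by rewrite dim_vline; case: (_ != _); lia.
have [a1 [a1U a1r]] := separating_functional rU.
(* Scaling [a1] by its own value at [r - p0] makes [g r] a square, hence positive. *)
pose a2 : 'cV[R]_m := ((r - p0) '* a1) *: a1.
pose g (p : E) : R := (p - p0) '* a2.
have gU p : p - p0 \in U -> g p = 0.
  by move=> pU; rewrite /g dotZr (a1U (p - p0)) ?mulr0.
have gW p : p - p0 \in W -> g p = 0.
  by move=> pW; apply: gU; exact: (subvP (addvSl _ _)).
have gr : 0 < g r by rewrite /g dotZr -expr2 exprn_even_gt0.
have sg : [seq p <- s | 0 < g p] != [::].
  by rewrite -has_filter; apply/hasP; exists r.
(* Ratio test: the least quotient of slack by [g] is the largest [t] for which no point of [s]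
   crosses the hyperplane. *)
have [r' + r'min] := exists_minimizer (fun p => (b - p '* a) / g p) sg.
rewrite mem_filter => /andP[gr' r's].
set t := (b - r' '* a) / g r' in r'min.
have t0 : 0 <= t by apply: divr_ge0; [rewrite subr_ge0 sab | exact: ltW].
have a'E p : p '* (a + t *: a2) - (b + t * (p0 '* a2)) = p '* a - b + t * g p.
  by rewrite dotDr dotZr /g dotBl; ring.
have r'E : r' '* (a + t *: a2) = b + t * (p0 '* a2).
  by apply/eqP; rewrite -subr_eq0 a'E /t divfK ?(gt_eqF gr')// addrC subrKA subrr.
have tight' p : p - p0 \in W -> p '* a = b -> p '* (a + t *: a2) = b + t * (p0 '* a2).
  by move=> /gW gp pab; apply/eqP; rewrite -subr_eq0 a'E gp pab subrr mulr0 addr0.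
exists (a + t *: a2), (b + t * (p0 '* a2)); split.
- move=> p ps; rewrite -subr_le0 a'E; have pab := sab p ps.
  have [gp|gp] := ltP 0 (g p); last by have := mulr_ge0_le0 t0 gp; lra.
  by have := r'min p; rewrite mem_filter gp ps ler_pdivlMr// => /(_ isT); lra.
- by move=> p ps pab; apply: tight' => //; exact: tightW.
- by apply: tight'; rewrite ?subrr ?mem0v.
- rewrite -subr_lt0 a'E gU ?mulr0 ?addr0 ?subr_lt0//.
  by rewrite (subvP (addvSr _ _)) ?memv_line.
set W' := direction _ _.
have WW' : (W <= W')%VS.
  apply: direction_sub => p; rewrite mem_filter => /andP[/eqP pab ps].
  by apply: direction_mem; rewrite mem_filter ps tight' ?eqxx ?tightW.
rewrite ltn_neqAle dimvS // andbT dimv_leqif_sup //.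
(* The new tight point [r'] gives strict growth: [g] vanishes on [W] but is positive at [r']. *)
apply: contraTN gr' => W'W; rewrite gW ?ltxx// (subvP W'W)//.
by apply: direction_mem; rewrite mem_filter r's r'E eqxx.
Qed.

(** Each tilt raises the dimension of the contact set. It stops at [k], since [q] never becomes
    tight and so the contact set never spans everything. *)
Lemma exists_separating_facet s F q k :
  has_dim (convex_hull [set` s]) k.+1 -> face (convex_hull [set` s]) F ->
  F !=set0 -> q \in s -> ~ F q ->
  exists G, [/\ facet (convex_hull [set` s]) G, F `<=` G & ~ G q].
Proof.
set P := convex_hull [set` s] => Pk PF; have FE := face_convex_hull PF.
move=> F0 qs Fq; have [p0 [p0s Fp0]] : [set` s] `&` F !=set0.
  by apply/set0P/eqP => e; case: F0 => p; rewrite FE e convex_hull0.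
have sP p : p \in s -> P p by exact: sub_convex_hull.
have dV := (has_dim_convex_hull k.+1 p0s).1 Pk.
move: PF => [a [b [Pab Fab]]].
have {Pab} sab p : p \in s -> p '* a <= b by move=> /sP /Pab.
have p0ab : p0 '* a = b by move: Fp0; rewrite Fab; case.
have qab : q '* a < b.
  rewrite lt_neqAle sab// andbT; apply/eqP => qab.
  by apply: Fq; rewrite Fab; split=> //; exact: sP.
(* Only this inclusion is kept, because tilting replaces [a] and [b] and enlarges the contact
   set. *)
have {Fab} FT p : p \in s -> F p -> p '* a = b by rewrite Fab => _ [].
(* [N] bounds the number of tilts still needed. *)
have [N dN] : exists N, (k <= \dim (direction p0 (tight s a b)) + N)%N.
  by exists k; exact: leq_addl.
elim: N => [|N IHN] in a b sab p0ab qab FT dN *; last first.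
  have [dlt|dge] := ltnP (\dim (direction p0 (tight s a b))).+1 k.+1; last first.
    by apply: (IHN a b) => //; rewrite (leq_trans _ (leq_addr _ _)).
  rewrite -dV in dlt.
  have [a' [b' [sab' TT p0ab' qab' dlt']]] := tilt sab p0ab qab dlt.
  apply: (IHN a' b') => // [p ps Fp|]; first exact/TT/FT.
  by rewrite (leq_trans dN)// addnS -addSn leq_add2r.
have hab : forall p, [set` s] p -> p '* a <= b by exact: sab.
have TE : [set` tight s a b] = [set` s] `&` [set p | p '* a = b].
  apply/seteqP; split=> p /=; rewrite mem_filter; first by case/andP=> /eqP.
  by case=> -> ->; rewrite eqxx.
have GE := convex_hull_tight hab; rewrite -TE in GE.
have p0T : p0 \in tight s a b by rewrite mem_filter p0ab eqxx.
exists (convex_hull [set` tight s a b]); split.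
- exists k; split=> //; first (exists a, b; rewrite -GE; split=> //).
    exact: convex_hull_le.
  apply/(has_dim_convex_hull k p0T)/eqP; rewrite eqn_leq -{2}[\dim _]addn0 dN andbT.
  rewrite -ltnS -dV ltn_neqAle dimvS ?andbT; last first.
    by apply: direction_sub => p; rewrite mem_filter => /andP[_]; exact: direction_mem.
  rewrite dimv_leqif_sup; last first.
    by apply: direction_sub => p; rewrite mem_filter => /andP[_]; exact: direction_mem.
  (* The functional [a] vanishes on the direction space of the tight points but not at [q - p0]. *)
  apply/negP => /subvP /(_ _ (direction_mem p0 qs)) /dot_direction.
  move=> /(_ a) q0; move: qab; rewrite -subr_lt0 -p0ab -dotBl q0 ?ltxx// => p.
  by rewrite mem_filter p0ab => /andP[/eqP].
- rewrite FE; apply: convex_hull_min => p [ps Fp]; apply: sub_convex_hull.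
  by rewrite /= mem_filter FT ?eqxx.
- by rewrite -GE => -[_ /= qb]; rewrite qb ltxx in qab.
Qed.

(** * Faces of the multiplex *)

Section Multiplex.
Context {d n : nat}.
Implicit Types (x : 'I_n.+1 -> E).

Lemma multiplex_vertex P x i : multiplex d P x -> vertex P (x i).
Proof.
by move=> [_ _ xV _]; have : range x (x i) by [exists i]; rewrite -xV.
Qed.

Lemma multiplex_facet_mem P x (l j : 'I_n.+1) :
  (2 <= d)%N -> multiplex d P x -> multiplex_facet d x l (x j) <-> on_facet d n l j.
Proof.
move=> d2 xM; have [[PE _] xinj _ _] := xM.
have xP : range x `<=` P by rewrite PE; exact: sub_convex_hull.
have clampedE i : exists j, clamped x i = x j.
  by rewrite /clamped; case: ifP => _; [|case: ifP => _]; eexists.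
have ln := ltn_ord l; have jn := ltn_ord j; split.
- rewrite /multiplex_facet; set A := (X in convex_hull X) => lj.
  have AP : A `<=` range x.
    by move=> _ [i _ <-]; have [j' ->] := clampedE i; exists j'.
  have [|||i /= [lij li]] := @vertex_convex_hull P A (x j) _ _ _ lj.
  + exact: multiplex_vertex xM.
  + exact: subset_trans xP.
  + rewrite PE; apply: convex_hull_min => p /AP; exact: sub_convex_hull.
  rewrite /on_facet /clamped; case: ifP => [i0 /xinj <- /=|i0]; first by lia.
  case: ifP => [ni /xinj <- /=|ni /xinj <- /=]; first by lia.
  by rewrite inordK; lia.
- rewrite /on_facet => lj; apply: sub_convex_hull.
  have [ljE|ljN] := eqVneq (l : nat) j; last first.
    exists j%:Z; first by move=> /=; lia.
    by rewrite /clamped /= ltz_nat ltnNge -ltnS jn /= inord_val.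
  have [l0|ln'] : (l = 0 :> nat \/ l = n :> nat)%N by lia.
    (* The vertices [x_0] on [F_0] and [x_n] on [F_n] come from the clamped indices [-1] and
       [n + 1], which lie in the window because [d >= 2]. *)
    exists (-1); first by move=> /=; lia.
    by rewrite /clamped /=; congr x; apply: val_inj => /=; lia.
  exists n.+1%:Z; first by move=> /=; lia.
  rewrite /clamped /= ltz_nat ltnSn; congr x; apply: val_inj => /=; lia.
Qed.

(** The hypothesis covers [i = j], which is what handles a one-vertex clique. *)
Lemma face_clique P x (S : pred 'I_n.+1) : (2 <= d <= n)%N ->
  multiplex d P x ->
  (forall i j, S i -> S j -> face P (convex_hull [set x i; x j])) ->
  face P (convex_hull [set x i | i in [set i | S i]]).
Proof.
move=> dn xM xE; have [d2 _] := andP dn; have [[PE Pd] xinj _ facetE] := xM.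
set A := [set x i | i in _].
have [S0|S0] := pselect (exists i, S i); last first.
  have -> : A = set0 by rewrite -subset0 => p [i Si _]; apply: S0; exists i.
  by rewrite convex_hull0; exact: face_set0.
have [i0 i0S] := S0.
pose s := [seq x i | i <- enum 'I_n.+1].
have sE : [set` s] = range x.
  apply/seteqP; split=> p /=; first by case/mapP => i _ ->; exists i.
  by move=> [i _ <-]; apply/map_f; rewrite mem_enum.
rewrite -sE in PE.
have index_of_facet G : facet P G ->
    exists l : 'I_n.+1, forall j, G (x j) <-> on_facet d n l j.
  move=> PG; have : [set F | facet P F] G by []; rewrite facetE => -[l _ <-].
  by exists l => j; exact: (multiplex_facet_mem _ _ d2 xM).
have facet_index (l : 'I_n.+1) : facet P (multiplex_facet d x l).
  have : range (multiplex_facet d x) (multiplex_facet d x l) by exists l.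
  by rewrite -facetE.
have sepS (k : 'I_n.+1) : ~~ S k ->
    exists2 F, face P F & (forall j, S j -> F (x j)) /\ ~ F (x k).
  move=> kS; have [|l [lS lk]] := @on_facet_clique d n S i0 k dn i0S kS; last first.
    exists (multiplex_facet d x l); first by have [? []] := facet_index l.
    split=> [j /lS|]; rewrite (multiplex_facet_mem _ _ d2 xM)//; exact/negP.
  move=> i j {kS}k iS jS ki kj.
  pose F := convex_hull [set x i; x j].
  have FA : [set x i; x j] `<=` P.
    by rewrite PE => p [] ->; apply: sub_convex_hull; rewrite sE; eexists.
  have PF : face P F := xE _ _ iS jS.
  have Fi : F (x i) by apply: sub_convex_hull; left.
  have Fj : F (x j) by apply: sub_convex_hull; right.
  have Fk : ~ F (x k).
    have FP : F `<=` P by move: FA; rewrite PE; exact: convex_hull_min.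
    move=> /(vertex_convex_hull (multiplex_vertex k xM) FA FP) [] /xinj kE.
      by rewrite kE eqxx in ki.
    by rewrite kE eqxx in kj.
  have dS : d = d.-1.+1 by lia.
  rewrite dS PE in Pd; rewrite PE in PF.
  have [||G [PG FG Gk]] := exists_separating_facet Pd PF _ _ Fk.
  + by exists (x i).
  + by apply/map_f; rewrite mem_enum.
  rewrite -PE in PG; have [l lG] := index_of_facet G PG.
  by exists l; split; [apply/lG/FG|apply/lG/FG|apply/negP => /lG].
have exF : forall ks : seq 'I_n.+1, {subset ks <= predC S} ->
    exists2 F, face P F &
      (forall j, S j -> F (x j)) /\ (forall k, k \in ks -> ~ F (x k)).
  elim=> [_|k ks IHks /allP/= /andP[kS /allP/IHks [F1 PF1 [FS1 FN1]]]].
    (* The empty intersection is [P] itself, the face obtained when the clique contains every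
       vertex. *)
    exists P; first exact: face_full.
    split=> // j _; rewrite PE; apply: sub_convex_hull; rewrite sE; by exists j.
  have [F2 PF2 [FS2 FN2]] := sepS k kS.
  exists (F1 `&` F2); first exact: faceI.
  split=> [j jS|k']; first by split; [exact: FS1 | exact: FS2].
  by rewrite inE => /predU1P[-> []//|/FN1 ? []].
have [|F PF [FS FN]] := exF (enum (predC S)); first by move=> k; rewrite mem_enum.
suff -> : convex_hull A = F by [].
rewrite PE in PF; rewrite (face_convex_hull PF) sE; congr convex_hull.
apply/seteqP; split=> [_ [i Si <-]|p [[i _ <-] Fi]].
  by split; [exists i | exact: FS].
exists i => //=; apply/negPn/negP => iS.
by apply: (FN i) => //; rewrite mem_enum.
Qed.

End Multiplex.

End Polytopes.

(** * From faces to graphs *)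

(** The theorem equates graphs as records, so their proof fields are identified by proof
    irrelevance. *)
Lemma sgraph_ext (T : Type) (G H : sgraph T) :
  (forall u, gvert G u <-> gvert H u) ->
  (forall u v, gadj G u v <-> gadj H u v) -> G = H.
Proof.
case: G H => [V A Av Ai As] [V' A' Av' Ai' As'] /= VV' AA'.
have VE : V = V' by apply/funext => u; apply/propext.
have AE : A = A' by apply/funext => u; apply/funext => v; apply/propext.
by subst; congr SGraph; exact: Prop_irrelevance.
Qed.

Theorem theorem2p6 (R : realType) (m d n : nat) (P : set 'rV[R]_m)
    (x : 'I_n.+1 -> 'rV[R]_m) (G : sgraph 'rV[R]_m) :
  (2 <= d)%N -> (d <= n)%N ->
  multiplex d P x ->
  subgraph G (polytope_graph P) -> complete_graph G ->
  exists F : set 'rV[R]_m, face P F /\ G = polytope_graph F.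
Proof.
move=> d2 dn xM [GV GA] Gcomplete; have [[PE _] xinj xV _] := xM.
pose S : pred 'I_n.+1 := fun i => `[< gvert G (x i) >].
pose A := [set x i | i in [set i | S i]].
have GS : gvert G = A.
  apply/seteqP; split=> [v Gv|_ [i /asboolP Gi <-]//].
  have : [set v | vertex P v] v by exact: GV.
  by rewrite xV => -[i _ iv]; exists i => //; apply/asboolP; rewrite iv.
have AP : A `<=` P.
  by move=> _ [i _ <-]; rewrite PE; apply: sub_convex_hull; exists i.
have FP : convex_hull A `<=` P by move: AP; rewrite {1 2}PE; exact: convex_hull_min.
have PF : face P (convex_hull A).
  apply: (face_clique _ xM) => [|i j /asboolP Gi /asboolP Gj]; first exact/andP.
  have [->|/eqP ij] := eqVneq i j.
    rewrite setUid (_ : convex_hull _ = [set x j]); first exact: multiplex_vertex xM.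
    apply: smallest_id.
    apply: convex_setI01 => u v t _ _ -> -> /=.
    by rewrite -scalerDl subrKC scale1r.
  have : polytope_adj P (x i) (x j) by apply/GA/Gcomplete => // /xinj.
  by case=> _ _ _ [].
exists (convex_hull A); split=> //.
have FvA v : vertex (convex_hull A) v -> A v.
  move=> Fv; apply: (vertex_convex_hull Fv) => //; first exact: sub_convex_hull.
  by have [a [b [_ /seteqP[/(_ v erefl) []]]]] := Fv.
have AvF v : A v -> vertex (convex_hull A) v.
  move=> Av; have [i _ iv] := Av; apply: face_sub FP.
    by rewrite -iv; exact: multiplex_vertex xM.
  by move=> _ ->; exact: sub_convex_hull.
apply: sgraph_ext => [v|u v]; rewrite /= ?GS; first by split; [exact: AvF|exact: FvA].
(* Completeness of [G] supplies every edge of the face; conversely an edge of [P] inside the face is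
   an edge of the face. *)
split=> [Guv|[/FvA Au /FvA Av uv _]]; last by apply: Gcomplete; rewrite ?GS.
have [Pu Pv uv [Puv dim1]] : polytope_adj P u v := GA _ _ Guv.
have [] := gadj_vert Guv; rewrite GS => Au Av.
split; [exact: AvF|exact: AvF|by []|split=> //].
apply: face_sub Puv _ FP; apply: convex_hull_min => p [] ->; exact: sub_convex_hull.
Qed.
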